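(* Placement obliviousness fails for four rings. Namely, take the disk pan of radius $R=15$ in the plane, width $w=0.3$ and radii $\{10,\,5,\,4.9,\,4.8\}$. All four rings form the lex-max set (witnessed by the pan pair $\{10,5\}$ and the pair $\{4.9,4.8\}$ in the hole of the $10$, which has radius $9.7$). The best-fit greedy nests the $5$ in the hole of the $10$, is forced to place the $4.9$ in the pan, and then no container admits the $4.8$; whereas the worst-fit greedy places all four rings.
   Context: Model. Fix a width $w>0$ and a pan, here a closed disk of radius $R$ in the plane. An inventory is a finite list of radii $r_1>r_2>\dots>r_n>0$; ring $i$ has outer radius $r_i$ and hole radius $\max(0,r_i-w)$. A placement of a set $S$ of rings is a forest: each ring of $S$ has as parent either the pan or another ring of $S$ with $r_{\mathrm{child}}\le r_{\mathrm{parent}}-w$, and the children of each common parent must be packable in the parent's region (the pan, or a disk of radius $r-w$ for the hole of a ring of radius $r$), i.e. closed disks having the children's outer radii can be positioned inside that region with pairwise disjoint interiors. Feasibility depends only on the parent assignment (siblings may be rearranged freely). $S$ is feasible if it has a placement. The lex-max set $L$ is obtained by scanning the rings in decreasing radius and including ring $i$ whenever the already included rings together with $i$ form a feasible set. A descending greedy processes the rings in decreasing radius; when ring $i$ is processed, a container (the pan or the hole of an already placed ring) admits it if the container's current children together with ring $i$ are packable in it; the ring receives some admitting container as its permanent parent, and is skipped only if no container admits it. Best fit chooses the admitting container of smallest capacity (radius), worst fit the one of largest capacity. Placement obliviousness holds on an instance if every descending greedy execution, with any choice of admitting containers, places exactly the lex-max set. *)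

(* Defs.v *)
From HB Require Import structures.
From mathcomp Require Import all_boot all_order all_algebra.
From mathcomp Require Import all_classical all_reals all_analysis.
Set Implicit Arguments.
Unset Strict Implicit.
Unset Printing Implicit Defensive.
Import Order.TTheory GRing.Theory Num.Theory.
Import numFieldNormedType.Exports.
Local Open Scope classical_set_scope.
Local Open Scope ring_scope.

(* The library norm on R * R is the sup norm, hence the explicit Euclidean
   distance; the topology on R * R is the usual one. *)
Definition disk (R : realType) (c : R * R) (rho : R) : set (R * R) :=
  [set p | Num.sqrt ((p.1 - c.1) ^+ 2 + (p.2 - c.2) ^+ 2) <= rho].

(* Rings are the indices 'I_n, listed by decreasing outer radius r, so the
   scans below that follow [enum 'I_n] are scans in decreasing radius. *)
Definition inventory (R : realType) (n : nat) (r : 'I_n -> R) : Prop :=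
  (forall i, 0 < r i) /\ (forall i j : 'I_n, (i < j)%N -> r j < r i).

Definition container (n : nat) := option 'I_n.
Definition pan {n : nat} : container n := None.
Definition hole {n : nat} (j : 'I_n) : container n := Some j.

(* A partial parent assignment: [p i = None] when ring i is not placed,
   [p i = Some c] when ring i is placed with parent c. *)
Definition assignment (n : nat) := {ffun 'I_n -> option (container n)}.

Definition placed (n : nat) (p : assignment n) : {set 'I_n} :=
  [set i | isSome (p i)].

Definition children (n : nat) (p : assignment n) (c : container n) :
  {set 'I_n} := [set i | p i == Some c].

Definition unplaced {n : nat} : assignment n := [ffun=> None].

Definition assign (n : nat) (p : assignment n) (i : 'I_n) (c : container n) :
  assignment n := [ffun j => if j == i then Some c else p j].

Definition assignment_of (n : nat) (s : seq (option (container n))) :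
  assignment n := [ffun i : 'I_n => nth None s i].

Definition capacity (R : realType) (n : nat) (rho w : R) (r : 'I_n -> R)
    (c : container n) : R :=
  if c is Some j then Num.max 0 (r j - w) else rho.

Definition packable (R : realType) (n : nat) (r : 'I_n -> R) (a : R)
    (C : {set 'I_n}) : Prop :=
  exists x : 'I_n -> R * R,
    (forall i, i \in C -> disk (x i) (r i) `<=` disk (0, 0) a) /\
    (forall i j, i \in C -> j \in C -> i != j ->
       (disk (x i) (r i))° `&` (disk (x j) (r j))° = set0).

(* For 0 < w the second condition makes radii strictly decrease from parent
   to child, so the parent relation is automatically a forest. *)
Definition is_placement (R : realType) (n : nat) (rho w : R) (r : 'I_n -> R)
    (S : {set 'I_n}) (p : assignment n) : Prop :=
  [/\ placed p = S,
      forall i j, p i = Some (hole j) -> j \in S /\ r i <= r j - w &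
      forall c, packable r (capacity rho w r c) (children p c)].

Definition feasible (R : realType) (n : nat) (rho w : R) (r : 'I_n -> R)
    (S : {set 'I_n}) : Prop :=
  exists p, is_placement rho w r S p.

Definition lexmax (R : realType) (n : nat) (rho w : R) (r : 'I_n -> R) :
  {set 'I_n} :=
  foldl (fun S i => if `[< feasible rho w r (i |: S)%SET >]
                    then (i |: S)%SET else S)
        finset.set0 (enum 'I_n).

Definition available (n : nat) (p : assignment n) (c : container n) : bool :=
  if c is Some j then j \in placed p else true.

Definition admits (R : realType) (n : nat) (rho w : R) (r : 'I_n -> R)
    (p : assignment n) (i : 'I_n) (c : container n) : Prop :=
  available p c /\ packable r (capacity rho w r c) (i |: children p c)%SET.

(* [rule p i c] says that, in state p, the greedy may choose c for ring i
   among the admitting containers. *)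
Definition choice_rule (n : nat) :=
  assignment n -> 'I_n -> container n -> Prop.

Definition any_fit {n : nat} : choice_rule n := fun _ _ _ => True.

Definition best_fit (R : realType) (n : nat) (rho w : R) (r : 'I_n -> R) :
  choice_rule n := fun p i c =>
  forall c', admits rho w r p i c' ->
    capacity rho w r c <= capacity rho w r c'.

Definition worst_fit (R : realType) (n : nat) (rho w : R) (r : 'I_n -> R) :
  choice_rule n := fun p i c =>
  forall c', admits rho w r p i c' ->
    capacity rho w r c' <= capacity rho w r c.

Definition greedy_step (R : realType) (n : nat) (rho w : R) (r : 'I_n -> R)
    (rule : choice_rule n) (i : 'I_n) (p p' : assignment n) : Prop :=
  (exists c, [/\ admits rho w r p i c, rule p i c & p' = assign p i c]) \/
  ((forall c, ~ admits rho w r p i c) /\ p' = p).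

Fixpoint greedy_run (R : realType) (n : nat) (rho w : R) (r : 'I_n -> R)
    (rule : choice_rule n) (s : seq 'I_n) (p p' : assignment n) : Prop :=
  if s is i :: s' then
    exists2 q, greedy_step rho w r rule i p q & greedy_run rho w r rule s' q p'
  else p' = p.

Definition greedy (R : realType) (n : nat) (rho w : R) (r : 'I_n -> R)
    (rule : choice_rule n) (p : assignment n) : Prop :=
  greedy_run rho w r rule (enum 'I_n) unplaced p.

Definition placement_oblivious (R : realType) (n : nat) (rho w : R)
    (r : 'I_n -> R) : Prop :=
  forall p, greedy rho w r any_fit p -> placed p = lexmax rho w r.

(* Main.v *)
Require Import Defs.
From HB Require Import structures.
From mathcomp Require Import all_boot all_order all_algebra.
From mathcomp Require Import all_classical all_reals all_analysis.
From mathcomp Require Import ring lra.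
Set Implicit Arguments.
Unset Strict Implicit.
Unset Printing Implicit Defensive.
Import Order.TTheory GRing.Theory Num.Theory.
Import numFieldNormedType.Exports.
Local Open Scope classical_set_scope.
Local Open Scope ring_scope.

(** The instance works because of two facts about discs packed in a disc.
    Two discs fit in a disc of radius [t] exactly when their radii add up to
    at most [t] ([packable2]).  The disc of radius 10 in the pan of radius 15
    pushes every other disc to the opposite side of the pan, where two discs of
    radii at least 4.9 and 4.8 are then squeezed against each other and overlap
    ([opposite_discs_overlap], [not_packable3]).  There is no slack to waste
    here: 10 together with two discs of radius 4.8 does fit, just barely.

    Consequently the pan takes, besides the 10, at most one of the other three
    rings, and the hole of the 10, of radius 9.7, has to take the other two.
    Its capacity allows the pair 4.9, 4.8 (sum 9.7) but neither 5, 4.9 nor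
    5, 4.8, and no other hole holds anything.  Putting the 5 in the pan
    therefore leads to a full placement, whereas nesting the 5, which best fit
    does, leaves a single place, in the pan, for the last two rings.

    To make this a proof, packability is translated into inequalities between
    the Euclidean norms of the centres ([packableE]); the lemmas [admits_first]
    to [admits_fourth_spread] list the admitting containers in each state that
    occurs, which determines both greedy runs.  That the lex-max set is
    everything follows from one full placement, since the restriction of a
    placement to an initial segment of the scan is a placement
    ([lexmax_full]). *)

(** * Discs in the Euclidean plane *)

Section EuclideanPlane.
Variable R : realType.
Implicit Types (u v x y z : R * R) (r s t a : R).

Definition enorm v : R := Num.sqrt (v.1 ^+ 2 + v.2 ^+ 2).

Lemma enorm_ge0 v : 0 <= enorm v. Proof. exact: sqrtr_ge0. Qed.

Lemma sqr_enorm v : enorm v ^+ 2 = v.1 ^+ 2 + v.2 ^+ 2.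
Proof. by rewrite sqr_sqrtr // addr_ge0 ?sqr_ge0. Qed.

Lemma enormN v : enorm (- v) = enorm v.
Proof. by rewrite /enorm /= !sqrrN. Qed.

Lemma enorm_sqr_le v r : enorm v <= r -> v.1 ^+ 2 + v.2 ^+ 2 <= r ^+ 2.
Proof.
move=> vr; rewrite -sqr_enorm ler_sqr ?nnegrE ?enorm_ge0 //.
exact: le_trans (enorm_ge0 _) vr.
Qed.

Lemma enorm_sqr_ge v r :
  0 <= r -> r <= enorm v -> r ^+ 2 <= v.1 ^+ 2 + v.2 ^+ 2.
Proof. by move=> r0 rv; rewrite -sqr_enorm ler_sqr ?nnegrE ?enorm_ge0. Qed.

Lemma cauchy_schwarz u v :
  (u.1 * v.1 + u.2 * v.2) ^+ 2
    <= (u.1 ^+ 2 + u.2 ^+ 2) * (v.1 ^+ 2 + v.2 ^+ 2).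
Proof.
rewrite -subr_ge0; have -> : (u.1 ^+ 2 + u.2 ^+ 2) * (v.1 ^+ 2 + v.2 ^+ 2) -
  (u.1 * v.1 + u.2 * v.2) ^+ 2 = (u.1 * v.2 - u.2 * v.1) ^+ 2 by ring.
exact: sqr_ge0.
Qed.

Lemma enormD u v : enorm (u + v) <= enorm u + enorm v.
Proof.
have uv0 : 0 <= enorm u * enorm v by rewrite mulr_ge0 ?enorm_ge0.
have dot_le : u.1 * v.1 + u.2 * v.2 <= enorm u * enorm v.
  apply: le_trans (ler_norm _) _.
  rewrite -ler_sqr ?nnegrE // real_normK ?num_real // exprMn !sqr_enorm.
  exact: cauchy_schwarz.
rewrite -ler_sqr ?nnegrE ?addr_ge0 ?enorm_ge0 //.
rewrite sqrrD !sqr_enorm /= mulr2n; lra.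
Qed.

Lemma enormB u v : enorm (u - v) <= enorm u + enorm v.
Proof. by rewrite -[enorm v]enormN; exact: enormD. Qed.

Lemma enorm_dilate t v : 0 <= t -> enorm (t * v.1, t * v.2) = t * enorm v.
Proof.
by move=> t0; rewrite /enorm /= !exprMn -mulrDr sqrtrM ?sqr_ge0//
  sqrtr_sqr ger0_norm.
Qed.

Lemma enorm_horizontal t : enorm (t, 0) = `|t|.
Proof. by rewrite /enorm /= expr0n /= addr0 sqrtr_sqr. Qed.

Lemma abs_fst_le_enorm v : `|v.1| <= enorm v.
Proof.
by rewrite -ler_sqr ?nnegrE ?enorm_ge0 // real_normK ?num_real //
  sqr_enorm lerDl sqr_ge0.
Qed.

Lemma abs_snd_le_enorm v : `|v.2| <= enorm v.
Proof.
by rewrite -ler_sqr ?nnegrE ?enorm_ge0 // real_normK ?num_real //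
  sqr_enorm lerDr sqr_ge0.
Qed.

Lemma enorm_le_abs v : enorm v <= `|v.1| + `|v.2|.
Proof.
have -> : v = (v.1, 0) + (0, v.2).
  by case: v => x y; congr pair; rewrite /= ?addr0 ?add0r.
apply: le_trans (enormD _ _) _.
by rewrite enorm_horizontal /enorm /= expr0n /= !add0r addr0 sqrtr_sqr.
Qed.

Lemma diskE x r p : disk x r p = (enorm (p - x) <= r) :> Prop.
Proof. by []. Qed.

(** On the boundary circle a small dilation from the centre leaves the disc, so
    boundary points are not interior; elsewhere the triangle inequality leaves
    room for a small square ball of the product topology. *)
Lemma interior_disk x r :
  0 < r -> (disk x r)° = [set p | enorm (p - x) < r].
Proof.
move=> r0; apply/seteqP; split => p.
  move=> pin; have : disk x r p by exact: interior_subset pin.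
  rewrite diskE /= lt_neqAle => -> ; rewrite andbT; apply/eqP => pr.
  move: pin; rewrite /interior => /nbhs_ballP[e /= e0 sub].
  (* The dilation of ratio [1 + t] moves [p] by less than [e]. *)
  have t0 : 0 < e / (2 * r) by rewrite divr_gt0 // mulr_gt0.
  set t := e / (2 * r) in t0.
  have tr : t * r < e.
    have -> : t * r = e / 2 by rewrite /t; field; rewrite gt_eqF.
    by lra.
  pose q : R * R := (p.1 + t * (p - x).1, p.2 + t * (p - x).2).
  have /sub : ball p e q.
    split; rewrite /ball /= opprD addNKr normrN normrM gtr0_norm //;
      apply: le_lt_trans tr; rewrite ler_pM2l // -pr.
      exact: (abs_fst_le_enorm (p - x)).
    exact: (abs_snd_le_enorm (p - x)).
  rewrite diskE; have -> : q - x = ((1 + t) * (p - x).1, (1 + t) * (p - x).2).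
    by congr pair; rewrite /=; ring.
  rewrite enorm_dilate ?pr; last by lra.
  by rewrite mulrDl mul1r gerDl leNgt mulr_gt0.
move=> /= pr; rewrite /interior; apply/nbhs_ballP.
exists ((r - enorm (p - x)) / 2) => /=; first by rewrite divr_gt0 ?subr_gt0.
move=> q [q1 q2]; rewrite diskE.
have -> : q - x = (p - x) - (p - q) by rewrite opprB [RHS]addrC subrKA.
apply: le_trans (enormB _ _) _; rewrite -lerBrDl.
apply: le_trans (enorm_le_abs _) _; move: q1 q2; rewrite /ball /= => q1 q2; lra.
Qed.

(** Tested on the point of the inner disc that is farthest from the origin:
    it lies on the ray through the centre, and in any direction when the centre
    is the origin. *)
Lemma disk_subset x r a :
  0 <= r -> disk x r `<=` disk (0, 0) a <-> enorm x + r <= a.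
Proof.
move=> r0; split=> [sub | xra p]; last first.
  rewrite !diskE => px; apply: le_trans xra.
  have -> : p - (0, 0) = x + (p - x) by rewrite subr0 [RHS]addrC subrK.
  by apply: le_trans (enormD _ _) _; rewrite lerD2l.
have [x0|xn0] := eqVneq (enorm x) 0.
  have /sub : disk x r (x.1 + r, x.2).
    rewrite diskE; have -> : (x.1 + r, x.2) - x = (r, 0).
      by congr pair; rewrite /=; ring.
    by rewrite enorm_horizontal ger0_norm.
  rewrite diskE x0 add0r; apply: le_trans.
  have rE : enorm (r, 0) = r by rewrite enorm_horizontal ger0_norm.
  rewrite -[leLHS]rE.
  have -> : (r, 0) = ((x.1 + r, x.2) - (0,0)) - x by congr pair; rewrite /=; ring.
  by apply: le_trans (enormB _ _) _; rewrite x0 addr0.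
have xp : 0 < enorm x by rewrite lt_def xn0 enorm_ge0.
set t := r / enorm x; have t0 : 0 <= t by rewrite divr_ge0 // ltW.
have tE : t * enorm x = r by rewrite divfK.
have /sub : disk x r ((1 + t) * x.1, (1 + t) * x.2).
  rewrite diskE; have -> : ((1 + t) * x.1, (1 + t) * x.2) - x = (t * x.1, t * x.2).
    by congr pair; rewrite /=; ring.
  by rewrite enorm_dilate // tE.
rewrite diskE subr0 enorm_dilate; last by lra.
by rewrite mulrDl mul1r tE.
Qed.

(** When the centres are closer than [r + s], the point dividing the segment
    between them in ratio [r : s] is interior to both discs. *)
Lemma interior_disk_disjoint x y r s : 0 < r -> 0 < s ->
  (disk x r)° `&` (disk y s)° = set0 <-> r + s <= enorm (x - y).
Proof.
move=> r0 s0; rewrite !interior_disk //; split=> [dis | rs].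
  rewrite leNgt; apply/negP => xy.
  pose t := r / (r + s); have rs0 : 0 < r + s by rewrite addr_gt0.
  have t0 : 0 < t by rewrite divr_gt0.
  have tc0 : 0 < 1 - t.
    have -> : 1 - t = s / (r + s) by rewrite /t; field; rewrite gt_eqF.
    by rewrite divr_gt0.
  have trs : t * (r + s) = r by rewrite divfK // gt_eqF.
  pose p : R * R := (x.1 - t * (x - y).1, x.2 - t * (x - y).2).
  suff : ([set p | enorm (p - x) < r] `&` [set p | enorm (p - y) < s]) p.
    by rewrite dis.
  split=> /=.
    have -> : p - x = - (t * (x - y).1, t * (x - y).2).
      by congr pair; rewrite /=; ring.
    by rewrite enormN enorm_dilate ?ltW // -[ltRHS]trs ltr_pM2l.
  have -> : p - y = ((1 - t) * (x - y).1, (1 - t) * (x - y).2).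
    by congr pair; rewrite /=; ring.
  rewrite enorm_dilate ?ltW //.
  have -> : s = (1 - t) * (r + s) by rewrite mulrBl trs mul1r addrAC subrr add0r.
  by rewrite ltr_pM2l.
apply/seteqP; split=> // p [/= px py].
move: rs; rewrite leNgt => /negP; apply.
have -> : x - y = (p - y) - (p - x) by rewrite opprB [RHS]addrC subrKA.
apply: le_lt_trans (enormB _ _) _; rewrite addrC; exact: ltrD.
Qed.

(** [x] is the centre of a disc of radius 10 in the disc of radius 15; [y] and
    [z] satisfy the weakest constraints on discs of radii at least 4.9 and 4.8
    placed with it.  The distances to [x] force the scalar products of [x] with
    [y] and [z] down to -47.5 and -45, so by Cauchy-Schwarz [y + z] has norm at
    least 92.5 / 5 = 18.5, and the parallelogram identity bounds the squared
    distance of [y] and [z] by 2 * 10.1 ^ 2 + 2 * 10.2 ^ 2 - 18.5 ^ 2 = 69.85,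
    below 9.7 ^ 2. *)
Lemma opposite_discs_overlap x y z :
  enorm x <= 5 -> enorm y <= 101 / 10 -> enorm z <= 102 / 10 ->
  149 / 10 <= enorm (x - y) -> 148 / 10 <= enorm (x - z) ->
  enorm (y - z) < 97 / 10.
Proof.
move=> /enorm_sqr_le x5 /enorm_sqr_le y10 /enorm_sqr_le z10.
move=> /enorm_sqr_ge => /(_ ltac:(lra)) xy.
move=> /enorm_sqr_ge => /(_ ltac:(lra)) xz.
rewrite ltNge; apply/negP => /enorm_sqr_ge => /(_ ltac:(lra)) yz.
have dot : x.1 * (y + z).1 + x.2 * (y + z).2 <= - (925 / 10).
  by move: xy xz => /=; lra.
have dot2 : (925 / 10) ^+ 2 <= (x.1 * (y + z).1 + x.2 * (y + z).2) ^+ 2.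
  rewrite -[leRHS]sqrrN ler_sqr ?nnegrE; lra.
have sum : (x.1 ^+ 2 + x.2 ^+ 2) * ((y + z).1 ^+ 2 + (y + z).2 ^+ 2)
    <= 5 ^+ 2 * ((y + z).1 ^+ 2 + (y + z).2 ^+ 2).
  by rewrite ler_wpM2r // addr_ge0 ?sqr_ge0.
have cs := cauchy_schwarz x (y + z).
move: (le_trans dot2 (le_trans cs sum)) yz y10 z10 => /=; lra.
Qed.

End EuclideanPlane.

(** * Packings *)

Section Packing.
Variables (R : realType) (n : nat) (r : 'I_n -> R).
Hypothesis r_gt0 : forall i, 0 < r i.
Implicit Types (a : R) (C D : {set 'I_n}).

Lemma packableE a C : packable r a C <->
  exists x : 'I_n -> R * R,
    (forall i, i \in C -> enorm (x i) + r i <= a) /\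
    (forall i j, i \in C -> j \in C -> i != j ->
       r i + r j <= enorm (x i - x j)).
Proof.
split=> -[x [inside apart]]; exists x; split=> i.
- by move=> /inside /disk_subset; apply; exact: ltW.
- by move=> j iC jC ij; apply/interior_disk_disjoint => //; exact: apart.
- by move=> /inside ?; apply/disk_subset => //; exact: ltW.
- by move=> j iC jC ij; apply/interior_disk_disjoint => //; exact: apart.
Qed.

Lemma packable_sub a C D : C \subset D -> packable r a D -> packable r a C.
Proof.
move=> /fintype.subsetP CD [x [inside apart]]; exists x.
by split=> [i /CD /inside | i j /CD iD /CD jD] //; exact: apart.
Qed.

Lemma packable0 a : packable r a finset.set0.
Proof. by exists (fun=> 0); split=> [i|i j]; rewrite inE. Qed.

Lemma packable_le a C i : packable r a C -> i \in C -> r i <= a.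
Proof.
move=> /packableE[x [inside _]] /inside; apply: le_trans.
by rewrite lerDr enorm_ge0.
Qed.

Lemma packable1 a i : packable r a [set i]%SET <-> r i <= a.
Proof.
split=> [/packable_le->//|ria]; first by rewrite inE.
apply/packableE; exists (fun=> (0, 0)); split=> [j /set1P ->|j k].
  by rewrite enorm_horizontal normr0 add0r.
by move=> /set1P -> /set1P ->; rewrite eqxx.
Qed.

(** The optimal packing puts both centres on a diameter, each disc tangent to
    the container at one end. *)
Lemma packable2 a i j :
  i != j -> packable r a [set i; j]%SET <-> r i + r j <= a.
Proof.
move=> ij; split.
  move=> /packableE[x [inside apart]].
  have iC : i \in [set i; j]%SET by rewrite !inE eqxx.
  have jC : j \in [set i; j]%SET by rewrite !inE eqxx orbT.
  have := enormB (x i) (x j).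
  by have := apart _ _ iC jC ij; have := inside _ iC; have := inside _ jC; lra.
move=> rij; have ri := r_gt0 i; have rj := r_gt0 j; apply/packableE.
exists (fun k => if k == i then (r i - a, 0) else (a - r j, 0)).
have ji : (j == i) = false by rewrite eq_sym (negbTE ij).
split=> [k|k l].
  case/set2P=> ->; rewrite ?eqxx ?ji enorm_horizontal.
    by rewrite ler0_norm; lra.
  by rewrite ger0_norm; lra.
have horiz s t : (s, 0) - (t, 0) = (s - t, 0) :> R * R.
  by rewrite -[RHS]/(_,_) -[in RHS](subrr 0).
case/set2P=> -> /set2P[]-> //; rewrite ?eqxx // ?ji horiz enorm_horizontal => _.
  by rewrite ler0_norm; lra.
by rewrite ger0_norm; lra.
Qed.

Lemma not_packable3 C i j k :
  i \in C -> j \in C -> k \in C -> i != j -> i != k -> j != k ->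
  r i = 10 -> 49 / 10 <= r j -> 48 / 10 <= r k -> ~ packable r 15 C.
Proof.
move=> iC jC kC ij ik jk ri rj rk /packableE[x [inside apart]].
have := inside _ iC; have := inside _ jC; have := inside _ kC.
have := apart _ _ iC jC ij; have := apart _ _ iC kC ik.
have := apart _ _ jC kC jk; rewrite ri => yz xz xy zk yj xi.
by have := @opposite_discs_overlap R (x i) (x j) (x k); lra.
Qed.

End Packing.

(** * Greedy runs and the lex-max set *)

Section Greedy.
Variables (R : realType) (n : nat) (rho w : R) (r : 'I_n -> R).

Lemma unplacedE : unplaced = assignment_of [::] :> assignment n.
Proof. by apply/ffunP => i; rewrite !ffunE nth_nil. Qed.

Lemma assign_assignment_of (s : seq (option (container n))) (i : 'I_n) k :
  assign (assignment_of s) i k = assignment_of (set_nth None s i (Some k)).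
Proof. by apply/ffunP => j; rewrite !ffunE nth_set_nth. Qed.

(** The rule need only single out [k] among the admitting containers: this
    covers both a unique admitting container and a strict optimum. *)
Lemma greedy_step_forced (rule : choice_rule n) i p p' k :
  admits rho w r p i k ->
  (forall k', admits rho w r p i k' -> rule p i k' <-> k' = k) ->
  greedy_step rho w r rule i p p' <-> p' = assign p i k.
Proof.
move=> adm forced; split=> [[[k' [adm' rk' ->]]|[/(_ k)//]]|->].
  by have /forced[-> //] := adm'.
by left; exists k; split=> //; exact/forced.
Qed.

Lemma greedy_step_skip (rule : choice_rule n) i p p' :
  (forall k, ~ admits rho w r p i k) ->
  greedy_step rho w r rule i p p' <-> p' = p.
Proof.
move=> noadm; split=> [[[k [/noadm //]]|[//]]|->].
by right.
Qed.

Lemma greedy_run_cons (rule : choice_rule n) i s p q p' :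
  (forall q', greedy_step rho w r rule i p q' <-> q' = q) ->
  greedy_run rho w r rule (i :: s) p p' <-> greedy_run rho w r rule s q p'.
Proof.
move=> stepE; split=> [[q' /stepE ->]//|run]; exists q => //; exact/stepE.
Qed.

Lemma greedy_run_any_fit (rule : choice_rule n) s p p' :
  greedy_run rho w r rule s p p' -> greedy_run rho w r any_fit s p p'.
Proof.
elim: s p => //= i s IHs p [q [[k [adm _ qE]]|[noadm qE]] /IHs run].
  by exists q => //; left; exists k.
by exists q => //; right.
Qed.

(** Closure under parents matters: the rest of the placement disappears, so a
    ring kept inside a discarded one would lose its container. *)
Lemma feasible_parent_closed (S T : {set 'I_n}) p :
  is_placement rho w r S p -> T \subset S ->
  (forall i j, i \in T -> p i = Some (hole j) -> j \in T) ->
  feasible rho w r T.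
Proof.
move=> [pS nested packed] /fintype.subsetP TS closed.
exists [ffun i => if i \in T then p i else None]; split.
- apply/setP => i; rewrite inE ffunE; case: ifP => // iT.
  by move: (TS _ iT); rewrite -pS inE.
- move=> i j; rewrite ffunE; case: ifP => // iT pij.
  by split; [exact: closed iT pij | have [] := nested _ _ pij].
- move=> k; apply: packable_sub (packed k).
  by apply/fintype.subsetP => i; rewrite !inE ffunE; case: ifP.
Qed.

(** For [0 < w] a parent precedes its children in the scan, so every initial
    segment of the scan is closed under parents and hence feasible; the scan
    then never rejects a ring. *)
Lemma lexmax_full : inventory r -> 0 < w ->
  feasible rho w r [set: 'I_n]%SET -> lexmax rho w r = [set: 'I_n]%SET.
Proof.
move=> [r_gt0 r_decr] w0 [p pP].
pose step (S : {set 'I_n}) i :=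
  if `[< feasible rho w r (i |: S)%SET >] then (i |: S)%SET else S.
have parent_before i j : p i = Some (hole j) -> (j < i)%N.
  move=> pij; have [_ /(_ _ _ pij)[_ rij] _] := pP.
  rewrite ltnNge leq_eqVlt; apply/negP => /orP[|/r_decr];
    last by lra.
  move=> /eqP/val_inj ij.
  by move: rij; rewrite ij; lra.
have prefix_feasible m : feasible rho w r [set i in take m (enum 'I_n)]%SET.
  apply: feasible_parent_closed pP _ _ => [|i j]; first exact: finset.subsetT.
  rewrite !inE !in_take ?mem_enum // !index_enum_ord => im /parent_before.
  by move=> ji; exact: ltn_trans im.
have scan m : (m <= n)%N ->
    foldl step finset.set0 (take m (enum 'I_n)) = [set i in take m (enum 'I_n)]%SET.
  elim: m => [|m IHm] mn; first by rewrite take0 /=; apply/setP=> i; rewrite !inE.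
  have msz : (m < size (enum 'I_n))%N by rewrite size_enum_ord.
  have takeS : take m.+1 (enum 'I_n) = rcons (take m (enum 'I_n)) (Ordinal mn).
    by rewrite (take_nth (Ordinal mn)) // (nth_ord_enum _ (Ordinal mn)).
  rewrite takeS foldl_rcons IHm 1?ltnW // /step.
  have <- : [set i in rcons (take m (enum 'I_n)) (Ordinal mn)]%SET =
     (Ordinal mn |: [set i in take m (enum 'I_n)])%SET.
    by apply/setP => i; rewrite !inE mem_rcons inE.
  by rewrite -takeS; case: asboolP => // /(_ (prefix_feasible _)).
have := scan n (leqnn n); rewrite take_oversize ?size_enum_ord // => scanE.
by rewrite /lexmax -/step scanE; apply/setP=> i; rewrite !inE mem_enum.
Qed.

End Greedy.

(** * The four rings *)

Section FourRings.
Variable R : realType.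

Definition radii : 'I_4 -> R :=
  fun i => nth 0 [:: 10; 5; 49 / 10; 48 / 10] i.

Let rho : R := 15.
Let w : R := 3 / 10.
Let a : 'I_4 := @Ordinal 4 0 isT.
Let b : 'I_4 := @Ordinal 4 1 isT.
Let c : 'I_4 := @Ordinal 4 2 isT.
Let d : 'I_4 := @Ordinal 4 3 isT.

Lemma radii_inventory : inventory radii.
Proof.
split; first by move=> [[|[|[|[|//]]]] ?]; rewrite /radii /=; lra.
by move=> [[|[|[|[|//]]]] ?] [[|[|[|[|//]]]] ?] //= _; rewrite /radii /=; lra.
Qed.

Let radii_gt0 : forall i, 0 < radii i := proj1 radii_inventory.

Lemma capacity_hole_a : capacity rho w radii (hole a) = 97 / 10.
Proof. by rewrite /capacity /= /radii /= /w max_r; lra. Qed.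

Lemma enum_ord4 : enum 'I_4 = [:: a; b; c; d].
Proof. by apply: (inj_map val_inj); rewrite val_enum_ord. Qed.

(** The holes of the 5, the 4.9 and the 4.8 have radius at most 4.7 and are too
    small for every ring, which leaves the pan and the hole of the 10. *)
Lemma admitsE s i k :
  admits rho w radii (assignment_of s) i k <->
    (k = pan /\ packable radii 15 (i |: children (assignment_of s) pan)%SET) \/
    (k = hole a /\ isSome (nth None s 0) /\
     packable radii (97 / 10) (i |: children (assignment_of s) (hole a))%SET).
Proof.
rewrite /admits; split; last first.
  move=> [[->]|[-> [av]]]; first by split.
  by rewrite capacity_hole_a; split=> //=; rewrite inE ffunE.
case: k => [j|[_ pk]]; last by left.
move=> [av pk]; right.
have ri := packable_le radii_gt0 pk (setU11 _ _).
have j_a : j = a.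
  move: ri; case: j {av pk} => -[|[|[|[|//]]]] jlt.
    by move=> _; exact: val_inj.
  1-3: case: i => -[|[|[|[|//]]]] ?; rewrite /capacity /radii /= /w;
    rewrite leNgt => /negP[]; rewrite gt_max; lra.
rewrite j_a capacity_hole_a in av pk *.
by do 2?split=> //; move: av; rewrite /available inE ffunE.
Qed.

Ltac rings_eq :=
  apply/setP => -[[|[|[|[|//]]]] ?]; rewrite !inE ?ffunE.

(* In the names below, [nested] states have the 5 in the hole of the 10, and
   [spread] states have it in the pan. *)

Lemma admits_first k :
  admits rho w radii (assignment_of [::]) a k <-> k = pan.
Proof.
rewrite admitsE; split=> [[[]//|[_ []]//]|->]; left; split=> //.
have -> : (a |: children (assignment_of [::]) pan)%SET = [set a]%SET by rings_eq.
by apply/(packable1 radii_gt0) => //; rewrite /radii /=; lra.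
Qed.

Lemma admits_second k :
  admits rho w radii (assignment_of [:: Some pan]) b k <->
  k = pan \/ k = hole a.
Proof.
rewrite admitsE.
have -> : (b |: children (assignment_of [:: Some pan]) pan)%SET
  = [set a; b]%SET by rings_eq.
have -> : (b |: children (assignment_of [:: Some pan]) (hole a))%SET
  = [set b]%SET by rings_eq.
rewrite (packable2 radii_gt0) // (packable1 radii_gt0) // /radii /=;
  split=> [[[->]|[->]]|[->|->]]; [by left|by right| |].
  by left; split=> //; lra.
by right; do 2?split=> //; lra.
Qed.

Lemma admits_third_nested k :
  admits rho w radii (assignment_of [:: Some pan; Some (hole a)]) c k <->
  k = pan.
Proof.
rewrite admitsE.
have -> : (c |: children (assignment_of [:: Some pan; Some (hole a)]) pan)%SET
  = [set a; c]%SET by rings_eq.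
have -> : (c |: children (assignment_of [:: Some pan; Some (hole a)]) (hole a))%SET
  = [set b; c]%SET by rings_eq.
rewrite !(packable2 radii_gt0) // /radii /=.
split=> [[[->]//|[_ [_ big]]]|->]; first by exfalso; move: big; lra.
by left; split=> //; lra.
Qed.

(** The pan would have to hold 10, 4.9 and 4.8; this is where the best-fit
    run gets stuck. *)
Lemma admits_fourth_nested k :
  ~ admits rho w radii
      (assignment_of [:: Some pan; Some (hole a); Some pan]) d k.
Proof.
rewrite admitsE.
have -> : (d |: children (assignment_of [:: Some pan; Some (hole a); Some pan])
  (hole a))%SET = [set b; d]%SET by rings_eq.
rewrite (packable2 radii_gt0) // /radii /= => -[[_]|[_ [_]]]; last by lra.
apply: (@not_packable3 _ _ _ radii_gt0 _ a c d) => //;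
  rewrite ?inE ?ffunE // /radii /=; lra.
Qed.

Lemma admits_third_spread k :
  admits rho w radii (assignment_of [:: Some pan; Some pan]) c k <->
  k = hole a.
Proof.
rewrite admitsE.
have -> : (c |: children (assignment_of [:: Some pan; Some pan]) (hole a))%SET
  = [set c]%SET by rings_eq.
rewrite (packable1 radii_gt0) //; split=> [[[_]|[]//]|->]; last first.
  by right; do 2?split=> //; rewrite /radii /=; lra.
move=> pk; exfalso; move: pk.
apply: (@not_packable3 _ _ _ radii_gt0 _ a b c) => //;
  rewrite ?inE ?ffunE // /radii /=; lra.
Qed.

Lemma admits_fourth_spread k :
  admits rho w radii (assignment_of [:: Some pan; Some pan; Some (hole a)]) d k
  <-> k = hole a.
Proof.
rewrite admitsE.
have -> : (d |: children (assignment_of [:: Some pan; Some pan; Some (hole a)])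
  (hole a))%SET = [set c; d]%SET by rings_eq.
rewrite (packable2 radii_gt0) //; split=> [[[_]|[]//]|->]; last first.
  by right; do 2?split=> //; rewrite /radii /=; lra.
move=> pk; exfalso; move: pk.
apply: (@not_packable3 _ _ _ radii_gt0 _ a b d) => //;
  rewrite ?inE ?ffunE // /radii /=; lra.
Qed.

Let bf := best_fit rho w radii.
Let wf := worst_fit rho w radii.

Lemma capacity_hole_a_lt_pan :
  capacity rho w radii (hole a) < capacity rho w radii pan.
Proof. by rewrite capacity_hole_a /= /rho; lra. Qed.

Lemma greedy_step_unique rule s i k p :
  (forall k', admits rho w radii (assignment_of s) i k' <-> k' = k) ->
  rule (assignment_of s) i k ->
  greedy_step rho w radii rule i (assignment_of s) p <->
    p = assignment_of (set_nth None s i (Some k)).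
Proof.
move=> admE rk; rewrite -assign_assignment_of; apply: greedy_step_forced.
  exact/admE.
by move=> k' /admE ->.
Qed.

Lemma best_fit_unique s i k :
  (forall k', admits rho w radii (assignment_of s) i k' <-> k' = k) ->
  bf (assignment_of s) i k.
Proof. by move=> admE k' /admE ->. Qed.

Lemma worst_fit_unique s i k :
  (forall k', admits rho w radii (assignment_of s) i k' <-> k' = k) ->
  wf (assignment_of s) i k.
Proof. by move=> admE k' /admE ->. Qed.

(** The 5 is the only ring with a choice, and so the only step at which the two
    rules differ. *)
Lemma best_fit_second p :
  greedy_step rho w radii bf b (assignment_of [:: Some pan]) p <->
  p = assignment_of [:: Some pan; Some (hole a)].
Proof.
rewrite [X in _ <-> p = X](_ : _ = assign (assignment_of [:: Some pan]) b (hole a));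
  last by rewrite assign_assignment_of.
apply: greedy_step_forced => [|k /admits_second[]->].
    by apply/admits_second; right.
  split=> // /(_ (hole a)); rewrite leNgt capacity_hole_a_lt_pan.
  by rewrite admits_second => /(_ (or_intror erefl)).
by split=> // _ k' /admits_second[]-> //; exact/ltW/capacity_hole_a_lt_pan.
Qed.

Lemma worst_fit_second p :
  greedy_step rho w radii wf b (assignment_of [:: Some pan]) p <->
  p = assignment_of [:: Some pan; Some pan].
Proof.
rewrite [X in _ <-> p = X](_ : _ = assign (assignment_of [:: Some pan]) b pan);
  last by rewrite assign_assignment_of.
apply: greedy_step_forced => [|k /admits_second[]->].
    by apply/admits_second; left.
  by split=> // _ k' /admits_second[]-> //; exact/ltW/capacity_hole_a_lt_pan.
split=> // /(_ pan); rewrite leNgt capacity_hole_a_lt_pan.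
by rewrite admits_second => /(_ (or_introl erefl)).
Qed.

Lemma best_fit_first_two s p :
  greedy_run rho w radii bf [:: a, b & s] unplaced p <->
  greedy_run rho w radii bf s (assignment_of [:: Some pan; Some (hole a)]) p.
Proof.
rewrite unplacedE.
rewrite (greedy_run_cons _ _ (fun q => greedy_step_unique q
  admits_first (best_fit_unique admits_first))).
exact: (greedy_run_cons _ _ best_fit_second).
Qed.

Lemma best_fit_greedyE p :
  greedy rho w radii bf p <->
  p = assignment_of [:: Some pan; Some (hole a); Some pan].
Proof.
rewrite /greedy enum_ord4 best_fit_first_two.
rewrite (greedy_run_cons _ _ (fun q => greedy_step_unique q
  admits_third_nested (best_fit_unique admits_third_nested))).
exact: (greedy_run_cons [::] _ (fun q =>
  greedy_step_skip bf q admits_fourth_nested)).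
Qed.

Lemma worst_fit_greedyE p :
  greedy rho w radii wf p <->
  p = assignment_of [:: Some pan; Some pan; Some (hole a); Some (hole a)].
Proof.
rewrite /greedy enum_ord4 unplacedE.
rewrite (greedy_run_cons _ _ (fun q => greedy_step_unique q
  admits_first (worst_fit_unique admits_first))).
rewrite (greedy_run_cons _ _ worst_fit_second).
rewrite (greedy_run_cons _ _ (fun q => greedy_step_unique q
  admits_third_spread (worst_fit_unique admits_third_spread))).
exact: (greedy_run_cons [::] _ (fun q => greedy_step_unique q
  admits_fourth_spread (worst_fit_unique admits_fourth_spread))).
Qed.

Lemma spread_placement :
  is_placement rho w radii [set: 'I_4]%SET
    (assignment_of [:: Some pan; Some pan; Some (hole a); Some (hole a)]).
Proof.
split.
- by rings_eq.
- move=> [[|[|[|[|//]]]] ?] j; rewrite ffunE //= => -[<-];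
  split; rewrite ?inE // /radii /= /w; lra.
- case=> [j|].
    have [->|ja] := eqVneq j a.
      have -> : children (assignment_of [:: Some pan; Some pan; Some (hole a);
        Some (hole a)]) (Some a) = [set c; d]%SET by rings_eq.
      rewrite -/(hole a) capacity_hole_a; apply/(packable2 radii_gt0) => //.
      by rewrite /radii /=; lra.
    have -> : children (assignment_of [:: Some pan; Some pan; Some (hole a);
        Some (hole a)]) (Some j) = finset.set0.
      by rings_eq => //; apply/negbTE; rewrite /= eq_sym;
        move: ja; apply: contraNN => /eqP[->].
    exact: packable0.
  have -> : children (assignment_of [:: Some pan; Some pan; Some (hole a);
        Some (hole a)]) None = [set a; b]%SET by rings_eq.
  by apply/(packable2 radii_gt0) => //; rewrite /radii /= /rho; lra.
Qed.

Lemma lexmax_radii : lexmax rho w radii = [set: 'I_4]%SET.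
Proof.
apply: lexmax_full; [exact: radii_inventory|by rewrite /w; lra|].
exact: ex_intro spread_placement.
Qed.

(** A best-fit run is in particular an unrestricted run, and it omits the
    4.8. *)
Lemma radii_not_oblivious : ~ placement_oblivious rho w radii.
Proof.
have bfrun : greedy rho w radii bf
  (assignment_of [:: Some pan; Some (hole a); Some pan]) by exact/best_fit_greedyE.
move=> /(_ _ (greedy_run_any_fit bfrun)); rewrite lexmax_radii => /setP /(_ d).
by rewrite !inE ffunE.
Qed.

End FourRings.

Theorem theorem13 (R : realType) :
  let rho : R := 15 in
  let w : R := 3 / 10 in
  let r : 'I_4 -> R := fun i => nth 0 [:: 10; 5; 49 / 10; 48 / 10] i in
  let a : 'I_4 := @Ordinal 4 0 isT in
  let b : 'I_4 := @Ordinal 4 1 isT in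
  let c : 'I_4 := @Ordinal 4 2 isT in
  let d : 'I_4 := @Ordinal 4 3 isT in
  (inventory r /\ ~ placement_oblivious rho w r) /\
  [/\ lexmax rho w r = [set: 'I_4]%SET,
      is_placement rho w r [set: 'I_4]%SET
        (assignment_of [:: Some pan; Some pan; Some (hole a); Some (hole a)]) &
      capacity rho w r (hole a) = 97 / 10] /\
  [/\ forall p, greedy_run rho w r (best_fit rho w r) [:: a; b] unplaced p <->
        p = assignment_of [:: Some pan; Some (hole a)],
      forall k, admits rho w r (assignment_of [:: Some pan; Some (hole a)]) c k
        <-> k = pan,
      forall k, ~ admits rho w r
        (assignment_of [:: Some pan; Some (hole a); Some pan]) d k &
      forall p, greedy rho w r (best_fit rho w r) p <->
        p = assignment_of [:: Some pan; Some (hole a); Some pan]] /\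
  (exists p, greedy rho w r (worst_fit rho w r) p) /\
  (forall p, greedy rho w r (worst_fit rho w r) p ->
     placed p = [set: 'I_4]%SET).
Proof.
move=> rho w r a b c d; split; [|split; [|split; [|split]]].
- by split; [exact: radii_inventory | exact: radii_not_oblivious].
- by split; [exact: lexmax_radii | exact: spread_placement
            | exact: capacity_hole_a].
- split; [exact: (@best_fit_first_two R [::]) | exact: admits_third_nested
         | exact: admits_fourth_nested | exact: best_fit_greedyE].
- by eexists; exact/worst_fit_greedyE.
- move=> p /worst_fit_greedyE ->; by have [] := spread_placement R.
Qed.
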